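(* A graph-based logic $\vdash$ has an algebraic semantics if and only if one of the following holds: (i) $\vdash$ is assertional; (ii) $\vdash$ has a unary connective $\Box$ and $x\vdash\Box x$; (iii) $\vdash$ has a unary connective $\Box$ and the rules in $\mathcal U\cup\mathcal S_{k,i}\cup\mathcal R_{k,i}\cup\mathcal I_{k,i}$ are valid in $\vdash$ for some positive integer $k$ and some ordinal $i<\alpha$; (iv) $\vdash$ is almost assertional and there is a set of equations $\boldsymbol\tau(x)$ such that (a) there is no substitution $\sigma$ with $\sigma(\epsilon)=\sigma(\delta)$ for all $\epsilon\approx\delta\in\boldsymbol\tau$, and (b) for every $\epsilon\approx\delta\in\boldsymbol\tau$ and every formula $\varphi(v,\vec z)$, $\{x,\varphi(\epsilon,\vec z)\}\dashv\vdash\{\varphi(\delta,\vec z),x\}$. Moreover, when (iii) holds, $k$ can be taken to be the least positive integer $n$ for which the rules in $\mathcal S_{n,i}$ are valid in $\vdash$.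
   Context: A logic $\vdash$ is a substitution-invariant consequence relation on the formulas (over a denumerable set of variables) of a language; a rule $\Gamma\rhd\varphi$ is valid in $\vdash$ if $\Gamma\vdash\varphi$. A logic is graph-based if its connectives have arity $\le1$ and there is at most one unary connective; its unary connective (if any) is denoted $\Box$ and its constants are $\{\mathbf c_j: j<\alpha\}$ for an ordinal $\alpha$. For $X\subseteq\omega$ nonempty, $\gcd(X)$ is the greatest common divisor, and $\gcd(\emptyset):=0$. Rule sets (for a positive integer $k$ and an ordinal $i<\alpha$): $\mathcal U$ consists of $x,y,\Box^nx\rhd\Box^ny$ for $n\in\omega$; $\mathcal S_{k,i}$ consists of $x,\Box^{k+n}x\rhd\Box^n\mathbf c_i$ and $x,\Box^n\mathbf c_i\rhd\Box^{k+n}x$ for $n\in\omega$; $\mathcal R_{k,i}$ consists of the rules $\{\Box^tx\}\cup\{\Box^{u_j}x: j<s\}\cup\{\Box^{v_j}x: j<s\}\rhd\Box^{t+g}x$ where $t,s,g\in\omega$, $u_j<v_j$ for all $j<s$, and $g$ is a multiple of $\gcd\{v_j-u_j: j<s\}$; $\mathcal I_{k,i}$ consists of the rules $\{\Box^{u_j}x: j<s\}\cup\{\Box^{v_j}x: j<s\}\rhd\Box^g\mathbf c_i$ where $s,g\in\omega$, $u_j<v_j$ for all $j<s$, and $g+k$ is a multiple of $\gcd\{v_j-u_j: j<s\}$. A matrix is a pair $\langle\boldsymbol A,F\rangle$ with $F\subseteq A$; $\mathsf M$ is a matrix semantics for $\vdash$ if $\Gamma\vdash\varphi$ iff for all $\langle\boldsymbol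 A,F\rangle\in\mathsf M$ and homomorphisms $h$ from the formula algebra to $\boldsymbol A$, $h[\Gamma]\subseteq F$ implies $h(\varphi)\in F$. $\vdash$ is assertional if it has a matrix semantics $\mathsf M$ with a formula $\psi(x)$ such that for every $\langle\boldsymbol A,F\rangle\in\mathsf M$ the term function $\psi^{\boldsymbol A}$ is constant and $F=\{\psi^{\boldsymbol A}\}$; $\vdash$ is almost assertional if it has no theorems and has a matrix semantics $\mathsf M$ with a formula $\psi(x)$ such that $\psi^{\boldsymbol A}$ is constant and $F=\{\psi^{\boldsymbol A}\}$ for every $\langle\boldsymbol A,F\rangle\in\mathsf M$ with $F\ne\emptyset$. A logic has an algebraic semantics if there are a set of equations $\boldsymbol\tau(x)$ in one variable and a class $\mathsf K$ of algebras such that $\Gamma\vdash\varphi$ iff $\boldsymbol\tau[\Gamma]\vDash_{\mathsf K}\boldsymbol\tau(\varphi)$ ($\boldsymbol\tau[\Gamma]$ the instances of $\boldsymbol\tau$ with $x$ replaced by members of $\Gamma$; $\vDash_{\mathsf K}$ equational consequence relative to $\mathsf K$). *)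

(* Defs.v *)
From mathcomp Require Import all_boot.
From mathcomp Require Import boolp classical_sets.

Set Implicit Arguments.
Unset Strict Implicit.
Unset Printing Implicit Defensive.

Local Open Scope classical_set_scope.

(* The constants are indexed by an arbitrary type rather than by an ordinal:
   only membership in the index set matters. *)
Record language := Language {
  const_sym : Type;
  unary_sym : Type;
  unary_unique : forall f g : unary_sym, f = g
}.

Inductive form (L : language) : Type :=
| Var of nat
| Const of const_sym L
| Box of unary_sym L & form L.

Arguments Var {L}.

Record algebra (L : language) := Algebra {
  carrier :> Type;
  carrier_inhabited : inhabited carrier;
  constant_op : const_sym L -> carrier;
  unary_op : unary_sym L -> carrier -> carrier
}.

Definition form_algebra (L : language) : algebra L :=
  Algebra (inhabits (Var 0)) (@Const L) (@Box L).

Definition is_hom (L : language) (A B : algebra L) (h : A -> B) : Prop :=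
  (forall c, h (constant_op A c) = constant_op B c) /\
  (forall f a, h (unary_op f a) = unary_op f (h a)).

Fixpoint eval (L : language) (A : algebra L) (e : nat -> A) (p : form L) : A :=
  match p with
  | Var n => e n
  | Const c => constant_op A c
  | Box f q => unary_op f (eval e q)
  end.

Definition is_substitution (L : language) (s : form L -> form L) : Prop :=
  @is_hom L (form_algebra L) (form_algebra L) s.

Definition subst1 (L : language) (n : nat) (q p : form L) : form L :=
  @eval L (form_algebra L) (fun m => if m == n then q else Var m) p.

(* [Var 0] plays the role of the variable x, and [Var 1] that of y;
   [in_x p] says that p is of the form p(x). *)
Fixpoint in_x (L : language) (p : form L) : Prop :=
  match p with
  | Var n => n = 0
  | Const _ => True
  | Box _ q => in_x q
  end.

Record logic (L : language) := Logic {
  entails : set (form L) -> form L -> Prop;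
  entails_refl : forall G p, G p -> entails G p;
  entails_mono : forall G D p, G `<=` D -> entails G p -> entails D p;
  entails_cut : forall G D p,
    (forall q, D q -> entails G q) -> entails D p -> entails G p;
  entails_subst : forall s G p,
    is_substitution s -> entails G p -> entails (s @` G) (s p)
}.

Definition interderivable (L : language) (l : logic L) (G D : set (form L)) :=
  (forall p, D p -> entails l G p) /\ (forall p, G p -> entails l D p).

Definition rule (L : language) : Type := (set (form L) * form L)%type.

Definition valid (L : language) (l : logic L) (X : set (rule L)) : Prop :=
  forall r, X r -> entails l r.1 r.2.

Definition boxn (L : language) (f : unary_sym L) (n : nat) (p : form L) : form L :=
  iter n (Box f) p.

Definition rules_U (L : language) (f : unary_sym L) : set (rule L) :=
  [set r | exists n,
    r = ([set Var 0; Var 1; boxn f n (Var 0)], boxn f n (Var 1))].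

Definition rules_S (L : language) (f : unary_sym L) (k : nat) (i : const_sym L) :
    set (rule L) :=
  [set r | exists n,
    r = ([set Var 0; boxn f (k + n) (Var 0)], boxn f n (Const i)) \/
    r = ([set Var 0; boxn f n (Const i)], boxn f (k + n) (Var 0))].

(* The gcd of the empty family is 0, whose only multiple is 0. *)
Definition gcd_diff (s : nat) (u v : 'I_s -> nat) : nat :=
  \big[gcdn/0]_(j < s) (v j - u j).

Definition premises (L : language) (f : unary_sym L) (s : nat) (u v : 'I_s -> nat) :
    set (form L) :=
  [set p | exists j, p = boxn f (u j) (Var 0)] `|`
  [set p | exists j, p = boxn f (v j) (Var 0)].

(* Does not actually depend on k and i. *)
Definition rules_R (L : language) (f : unary_sym L) (k : nat) (i : const_sym L) :
    set (rule L) :=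
  [set r | exists (t s g : nat) (u v : 'I_s -> nat),
    [/\ forall j, u j < v j,
        gcd_diff u v %| g &
        r = ([set boxn f t (Var 0)] `|` premises f u v,
             boxn f (t + g) (Var 0))]].

Definition rules_I (L : language) (f : unary_sym L) (k : nat) (i : const_sym L) :
    set (rule L) :=
  [set r | exists (s g : nat) (u v : 'I_s -> nat),
    [/\ forall j, u j < v j,
        gcd_diff u v %| g + k &
        r = (premises f u v, boxn f g (Const i))]].

Record lmatrix (L : language) := LMatrix {
  matrix_algebra :> algebra L;
  designated : set matrix_algebra
}.

Arguments designated {L} l _.

Definition matrix_semantics (L : language) (l : logic L)
    (M : set (lmatrix L)) : Prop :=
  forall (G : set (form L)) (p : form L),
    entails l G p <->
    (forall A : lmatrix L, M A ->
     forall h : form L -> A, @is_hom L (form_algebra L) A h ->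
       h @` G `<=` designated A -> designated A (h p)).

Definition designates_only (L : language) (A : lmatrix L) (p : form L) : Prop :=
  exists a : A, (forall b : A, eval (fun=> b) p = a) /\ designated A = [set a].

Definition assertional (L : language) (l : logic L) : Prop :=
  exists (M : set (lmatrix L)) (p : form L),
    [/\ matrix_semantics l M, in_x p &
        forall A, M A -> designates_only A p].

Definition almost_assertional (L : language) (l : logic L) : Prop :=
  (forall p, ~ entails l set0 p) /\
  exists (M : set (lmatrix L)) (p : form L),
    [/\ matrix_semantics l M, in_x p &
        forall A, M A -> designated A <> set0 -> designates_only A p].

Definition equation (L : language) : Type := (form L * form L)%type.

Definition equations_in_x (L : language) (tau : set (equation L)) : Prop :=
  forall e, tau e -> in_x e.1 /\ in_x e.2.

Definition instances (L : language) (tau : set (equation L))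
    (G : set (form L)) : set (equation L) :=
  [set d | exists p e,
    [/\ G p, tau e & d = (subst1 0 p e.1, subst1 0 p e.2)]].

Definition eq_conseq (L : language) (K : set (algebra L))
    (T : set (equation L)) (e : equation L) : Prop :=
  forall A : algebra L, K A ->
  forall h : form L -> A, @is_hom L (form_algebra L) A h ->
    (forall d, T d -> h d.1 = h d.2) -> h e.1 = h e.2.

Definition has_algebraic_semantics (L : language) (l : logic L) : Prop :=
  exists (tau : set (equation L)) (K : set (algebra L)),
    equations_in_x tau /\
    forall (G : set (form L)) (p : form L),
      entails l G p <->
      (forall e, instances tau [set p] e -> eq_conseq K (instances tau G) e).

(* Main.v *)
(** Algebraic semantics, and likewise assertional matrix semantics, can always
    be taken to consist of quotients of the formula algebra, so everything
    reduces to theories and congruences: a logic has an algebraic semantics with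
    equations tau iff every theory G admits a congruence R of the formula algebra
    with q \in G <-> tau(q) \subset R; such a G is a union of R-classes.

    Equations without variables, and equations [Box^a x = Box^b x], are inherited
    from [x] by every [Box^j x]. An equation [Box^m x = Box^n c] identifies
    [Box^m p] with [Box^m q] for p, q in G, so it holds of [Box^j p] iff it holds
    of [Box^j q]; this yields the rules U. If [x |- Box x] fails, tau contains such
    an equation; choose m least. If n < m, and no equation
    [Box^a x = Box^b x] with a < m, a < b is in tau, then [Box^(m-n) x] and [c]
    behave alike and the rules S with k = m - n follow. In the other cases some
    [Box^N c] follows from [x].

    Given U, the set of n with [Box^n p \in G] is, for every p in G, closed under
    sums and differences, hence of the form D * nat. This makes the rules R, and
    with S the rules I, redundant, and it gives the congruence needed for the
    converse: identify [Box^(k+n) p] (p in G) with [Box^m c] for n = m mod D. *)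
Require Import Defs.
From mathcomp Require Import all_boot.
From mathcomp Require Import boolp classical_sets.
From mathcomp Require Import zify.

Set Implicit Arguments.
Unset Strict Implicit.
Unset Printing Implicit Defensive.

Local Open Scope classical_set_scope.

(** * Sets of natural numbers closed under sums and differences *)

(** [D] is the least positive element of [T], or 0 if there is none. A remainder modulo [D] stays in
    [T] as a difference, so it must vanish. *)
Lemma nat_closed_multiples (T : nat -> Prop) :
  T 0 -> (forall a b, T a -> T b -> T (a + b)) ->
  (forall a b, T a -> T (a + b) -> T b) ->
  exists D, forall n, T n <-> D %| n.
Proof.
move=> T0 TD TB.
have TM a j : T a -> T (j * a).
  by move=> Ta; elim: j => [|j IHj]; rewrite ?mul0n // mulSn; apply: TD.
have [[d [d0 Td]]|noT] := pselect (exists d, 0 < d /\ T d); last first.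
  exists 0 => n; rewrite dvd0n; split=> [Tn|/eqP->//].
  by case: n Tn => // n Tn; case: noT; exists n.+1.
have exT : exists n, (0 < n) && `[< T n >].
  by exists d; rewrite d0; apply/asboolP.
case: (ex_minnP exT) => D /andP[D0 /asboolP TDD] minD.
exists D => n; split=> [Tn|/dvdnP[j ->]]; last exact: TM.
have Tmod : T (n %% D).
  by apply: (TB (n %/ D * D)); [exact: TM | rewrite -divn_eq].
rewrite /dvdn -leqn0 leqNgt; apply/negP => mod0.
have := minD (n %% D); rewrite mod0 /= leqNgt ltn_pmod // => /(_ _)/negP.
by apply=> //; apply/asboolP.
Qed.

(** * Formulas and substitutions *)

Section Formulas.
Variable L : language.
Implicit Types (p q : form L) (A : algebra L).

Lemma hom_eval A (h : form L -> A) p :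
  @is_hom L (form_algebra L) A h -> h p = eval (fun n => h (Var n)) p.
Proof.
by case=> hc hu; elim: p => [n|c|f p IHp] //=; rewrite ?(hu f p) ?IHp //; apply: hc.
Qed.

Lemma eval_is_hom A (e : nat -> A) : @is_hom L (form_algebra L) A (eval e).
Proof. by []. Qed.

Lemma eval_in_x A (e : nat -> A) p : in_x p -> eval e p = eval (fun=> e 0) p.
Proof. by elim: p => [n ->|c|f p IHp] //= /IHp ->. Qed.

Lemma subst1_in_x p q :
  in_x p -> subst1 0 q p = @eval L (form_algebra L) (fun=> q) p.
Proof. by move=> px; rewrite /subst1 eval_in_x. Qed.

Lemma hom_subst1 A (h : form L -> A) p q :
  @is_hom L (form_algebra L) A h -> in_x p ->
  h (subst1 0 q p) = eval (fun=> h q) p.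
Proof.
move=> hom_h px; rewrite subst1_in_x // (hom_eval _ hom_h).
case: hom_h => hc hu; elim: p px => [n|c|f p IHp] //=.
  by move=> _; rewrite -hom_eval.
by move=> /IHp ->.
Qed.

Lemma substitution_subst1 (s : form L -> form L) p q :
  is_substitution s -> in_x p -> s (subst1 0 q p) = subst1 0 (s q) p.
Proof. by move=> s_sub px; rewrite (hom_subst1 _ s_sub) // subst1_in_x. Qed.

Lemma in_x_collapse p : in_x (@eval L (form_algebra L) (fun=> Var 0) p).
Proof. by elim: p. Qed.

Lemma hom_boxn A (h : form L -> A) f n p :
  @is_hom L (form_algebra L) A h ->
  h (boxn f n p) = iter n (unary_op f) (h p).
Proof.
by case=> hc hu; elim: n => //= n IHn; rewrite -IHn -(hu f (boxn f n p)).
Qed.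

Lemma subst1_var0 p : subst1 0 (Var 0) p = p.
Proof.
rewrite /subst1; elim: p => [n|c|f p IHp] //=; first by case: eqP => // ->.
by rewrite IHp.
Qed.

Lemma subst1_boxn f n v q p :
  subst1 v q (boxn f n p) = boxn f n (subst1 v q p).
Proof. by rewrite /subst1 (hom_boxn _ _ _ (eval_is_hom _)). Qed.

Lemma boxnD f m n p : boxn f (m + n) p = boxn f m (boxn f n p).
Proof. exact: iterD. Qed.

Lemma boxn_inj f n p q : boxn f n p = boxn f n q -> p = q.
Proof. by elim: n => //= n IHn [] /IHn. Qed.

Lemma boxn_const f n p c : boxn f n p = Const c -> n = 0.
Proof. by case: n. Qed.

Lemma Box_neq f p : p <> Box f p.
Proof. by elim: p => // g p IHp []; rewrite (unary_unique g f). Qed.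

Lemma in_x_boxn f p :
  in_x p -> exists n, p = boxn f n (Var 0) \/ exists c, p = boxn f n (Const c).
Proof.
elim: p => [n ->|c _|g p IHp /IHp[n np]]; first by exists 0; left.
  by exists 0; right; exists c.
rewrite (unary_unique g f); exists n.+1.
by case: np => [->|[c ->]]; [left|right; exists c].
Qed.

Lemma in_x_boxn_var (f : unary_sym L) n : in_x (boxn f n (Var 0)).
Proof. by elim: n. Qed.

Lemma in_x_boxn_const (f : unary_sym L) n c : in_x (boxn f n (Const c)).
Proof. by elim: n. Qed.

End Formulas.

(** * Congruences and quotients of the formula algebra *)

Section Quotient.
Variable L : language.
Implicit Types p q : form L.

Record congruence (R : form L -> form L -> Prop) : Prop := Congruence {
  congr_refl : forall p, R p p;
  congr_sym : forall p q, R p q -> R q p;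
  congr_trans : forall p q r, R p q -> R q r -> R p r;
  congr_box : forall f p q, R p q -> R (Box f p) (Box f q)
}.

Lemma congruence_eq : congruence eq.
Proof. by split=> // [p q r ->|f p q ->]. Qed.

Section Classes.
Variable R : form L -> form L -> Prop.

(** The choice depends on [p] only through the predicate [R p], so congruent formulas share a
    representative. The default [Var 0] never occurs for a reflexive [R]. *)
Definition canon p : form L :=
  if pselect (ex (R p)) is left Rp then sval (cid Rp) else Var 0.

(* Canonical representatives rather than R-classes: a type of sets of formulas
   would live in too large a universe to be the carrier of an algebra. *)
Definition quotient := {p : form L | exists q, p = canon q}.

Definition class_of p : quotient := exist _ (canon p) (ex_intro _ p erefl).

Definition quotient_algebra : algebra L :=
  Algebra (inhabits (class_of (Var 0))) (fun c => class_of (Const c))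
          (fun f X => class_of (Box f (sval X))).

Hypothesis R_congr : congruence R.

Lemma canonP p : R p (canon p).
Proof.
rewrite /canon; case: pselect => [Rp|[]]; first by case: cid.
by exists p; apply: congr_refl.
Qed.

Lemma class_of_eq p q : class_of p = class_of q <-> R p q.
Proof.
split=> [/(congr1 sval) /= pq|Rpq].
  apply: (congr_trans R_congr (canonP p)); rewrite pq.
  exact: (congr_sym R_congr (canonP q)).
apply: eq_exist; rewrite /canon; suff -> : R p = R q by [].
apply/funext => r; apply/propext; split.
  exact: congr_trans (congr_sym R_congr Rpq).
exact: congr_trans Rpq.
Qed.

Lemma class_of_sval (X : quotient) : class_of (sval X) = X.
Proof.
case: X => p Hp; have [q pE] := Hp; apply: eq_exist; rewrite /= pE.
have /class_of_eq/(congr1 sval) // : R (canon q) q.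
exact: (congr_sym R_congr (canonP q)).
Qed.

Lemma class_of_hom : @is_hom L (form_algebra L) quotient_algebra class_of.
Proof.
split=> // f p; suff : class_of (Box f p) = class_of (Box f (canon p)) by [].
exact/class_of_eq/(congr_box R_congr)/canonP.
Qed.

(** The substitution sends each variable to the representative of its image under [h]. *)
Lemma hom_quotient_lift (h : form L -> quotient_algebra) :
  @is_hom L (form_algebra L) quotient_algebra h ->
  exists2 s, is_substitution s & forall p, h p = class_of (s p).
Proof.
move=> hom_h; pose s := @eval L (form_algebra L) (fun n => sval (h (Var n))).
exists s => // p; case: hom_h class_of_hom => hc hu [_ pu].
elim: p => [n|c|f p IHp] /=; first by rewrite class_of_sval.
  exact: hc.
by rewrite (hu f p) IHp -(pu f (s p)).
Qed.

Lemma congr_boxn f n p q : R p q -> R (boxn f n p) (boxn f n q).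
Proof. by move=> Rpq; elim: n => //= n IHn; apply: congr_box. Qed.

Lemma congr_subst1 v p q r : R p q -> R (subst1 v p r) (subst1 v q r).
Proof.
move=> Rpq; elim: r => [n|c|f r IHr]; rewrite /subst1 /=.
- by case: ifP => // _; apply: congr_refl.
- exact: congr_refl.
- exact: congr_box.
Qed.

End Classes.
End Quotient.

(** * Theories *)

Section Theories.
Variables (L : language) (l : logic L).
Implicit Types (p q : form L) (G T : set (form L)).

Definition is_theory T := forall p, entails l T p -> T p.

Lemma theory_rule T G p (s : form L -> form L) :
  is_theory T -> is_substitution s -> entails l G p ->
  (forall q, G q -> T (s q)) -> T (s p).
Proof.
move=> thT s_sub Gp GT; apply/thT/(entails_mono _ (entails_subst s_sub Gp)).
by move=> _ [q /GT Tq <-].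
Qed.

Lemma closure_theory G : is_theory (entails l G).
Proof. by move=> p; apply: entails_cut. Qed.

Lemma entails_theories G p :
  (forall T, is_theory T -> G `<=` T -> T p) -> entails l G p.
Proof.
move=> GTp; apply: (GTp (entails l G)); first exact: closure_theory.
by move=> q; apply: entails_refl.
Qed.

(** Collapsing all variables of a theorem to [x] turns it into a formula in [x] alone, which can
    then serve as a constant term. *)
Lemma theorem_collapse T p q :
  is_theory T -> entails l set0 p ->
  T (subst1 0 q (@eval L (form_algebra L) (fun=> Var 0) p)).
Proof.
pose s r := subst1 0 q (@eval L (form_algebra L) (fun=> Var 0) r).
by move=> thT lp; apply: (theory_rule (s := s) thT _ lp).
Qed.

(** * Algebraic semantics as congruences attached to theories *)

Definition theory_congruence (tau : set (equation L)) T
    (R : form L -> form L -> Prop) :=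
  congruence R /\
  forall q, T q <-> forall e, tau e -> R (subst1 0 q e.1) (subst1 0 q e.2).

(** Given [K], relate two formulas when the instances of [tau] over [T] imply their equation in [K].
    Conversely, [K] collects the quotients by all such congruences, and homomorphisms into them lift
    to substitutions. *)
Lemma algebraic_semanticsP :
  has_algebraic_semantics l <->
  exists tau, equations_in_x tau /\
    forall T, is_theory T -> exists R, theory_congruence tau T R.
Proof.
split=> [[tau [K [tau_x semK]]]|[tau [tau_x congrT]]]; exists tau.
  split=> // T thT; exists (fun p q => eq_conseq K (instances tau T) (p, q)).
  split.
    split=> [p A KA h homh hT //|p q pq A KA h homh hT
            |p q r pq qr A KA h homh hT|f p q pq A KA h homh hT] /=.
    - by rewrite -(pq A KA h).
    - by rewrite (pq A KA h homh hT) -(qr A KA h).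
    - by rewrite !(homh.2 f) (pq A KA h homh hT).
  move=> q; split=> [Tq e te|Tq].
    have /semK/(_ _) := entails_refl l Tq.
    by apply; exists q, e.
  by apply/thT/semK => _ [_ [e [-> te ->]]]; apply: Tq.
exists [set A | exists T R, [/\ is_theory T, theory_congruence tau T R &
                                A = quotient_algebra R]].
split=> // G p; split=> [Gp|Gp].
  move=> _ [_ [e [-> te ->]]] _ [T [R [thT [Rc TR] ->]]] h homh hG /=.
  have [s s_sub hs] := hom_quotient_lift Rc homh.
  have sub q e' : in_x e' -> s (subst1 0 q e') = subst1 0 (s q) e'.
    exact: substitution_subst1.
  have [e1 e2] := tau_x _ te.
  rewrite !hs; apply/class_of_eq => //; rewrite !sub //; move: e te {e1 e2}.
  apply/TR/(theory_rule thT s_sub Gp) => q Gq.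
  apply/TR => e te; have [e1 e2] := tau_x _ te; rewrite -!sub //.
  by apply/class_of_eq => //; rewrite -!hs; apply: (hG (_, _)); exists q, e.
apply: entails_theories => T thT GT; have [R TcR] := congrT T thT.
have [Rc TR] := TcR; apply/TR => e te; apply/(class_of_eq Rc).
apply: (Gp (_, _) _ (quotient_algebra R) _ (@class_of L R)).
- by exists p, e.
- by exists T, R.
- exact: class_of_hom.
- move=> _ [q [e' [Gq te' ->]]] /=; apply/class_of_eq => //.
  exact: (TR q).1 (GT _ Gq) _ te'.
Qed.

Lemma theory_congruence_compat tau T R p q :
  theory_congruence tau T R -> R p q -> T p -> T q.
Proof.
move=> [Rc TR] Rpq /TR Tp; apply/TR => e te.
apply: (congr_trans Rc (congr_sym Rc (congr_subst1 Rc _ _ Rpq))).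
exact: (congr_trans Rc (Tp e te) (congr_subst1 Rc _ _ Rpq)).
Qed.

(** * Assertional logics *)

(** A formula of this language has at most one occurrence of a variable, so contexts in [x] alone
    already give the Leibniz congruence, the largest one compatible with [T]. *)
Definition leibniz T p q :=
  forall r, in_x r -> T (subst1 0 p r) <-> T (subst1 0 q r).

Lemma leibniz_congruence T : congruence (leibniz T).
Proof.
split=> [p|p q pq|p q r pq qr|f p q pq] s sx.
- by [].
- by rewrite pq.
- by rewrite pq // qr.
(* The outer [Box] is absorbed into the context. *)
have subE t : subst1 0 (Box f t) s = subst1 0 t (subst1 0 (Box f (Var 0)) s).
  have tsub : is_substitution (subst1 0 t) by [].
  by rewrite (substitution_subst1 _ tsub).
have sx' : in_x (subst1 0 (Box f (Var 0)) s).
  by rewrite subst1_in_x //; elim: (s).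
by rewrite (subE p) (subE q) pq.
Qed.

Lemma leibniz_compat T p q : leibniz T p q -> T p -> T q.
Proof. by move=> /(_ (Var 0) erefl)[]. Qed.

Definition leibniz_matrix T : lmatrix L :=
  @LMatrix L (quotient_algebra (leibniz T)) (class_of (leibniz T) @` T).

Lemma leibniz_matrix_designated T p :
  designated (leibniz_matrix T) (class_of (leibniz T) p) <-> T p.
Proof.
split=> [[q Tq /class_of_eq qp]|Tp]; last by exists p.
exact: (leibniz_compat (qp (leibniz_congruence T))).
Qed.

Lemma leibniz_matrix_semantics :
  matrix_semantics l [set A | exists2 T, is_theory T & A = leibniz_matrix T].
Proof.
move=> G p; split=> [Gp _ [T thT ->] h homh hG|Gp].
  have [s s_sub hs] := hom_quotient_lift (leibniz_congruence T) homh.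
  rewrite hs; apply/leibniz_matrix_designated/(theory_rule thT s_sub Gp) => q Gq.
  by apply/leibniz_matrix_designated; rewrite -hs; apply: hG; exists q.
apply: entails_theories => T thT GT; apply/leibniz_matrix_designated.
apply: Gp; first by exists T.
  exact/class_of_hom/leibniz_congruence.
by move=> _ [q /GT Tq <-]; apply/leibniz_matrix_designated.
Qed.

(** This says that the members of a theory form at most one Leibniz class, so that its Leibniz
    matrix designates at most one element. *)
Definition interchangeable := forall T p q r, is_theory T -> in_x r ->
  T p -> T q -> T (subst1 0 p r) -> T (subst1 0 q r).

Lemma interchangeable_leibniz T p q :
  interchangeable -> is_theory T -> T p -> T q -> leibniz T p q.
Proof. by move=> lI thT Tp Tq r rx; split; apply: lI. Qed.

Lemma leibniz_matrix_designates_only T p :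
  interchangeable -> is_theory T -> in_x p -> (forall q, T (subst1 0 q p)) ->
  designates_only (leibniz_matrix T) p.
Proof.
move=> lI thT px Tp; have Rc := leibniz_congruence T.
exists (class_of (leibniz T) (subst1 0 (Var 0) p)); split=> [b|].
  rewrite -(class_of_sval Rc b) -(hom_subst1 _ (class_of_hom Rc)) //.
  by apply/(class_of_eq Rc); apply: interchangeable_leibniz.
apply/seteqP; split=> [_ [q Tq <-]|_ ->] /=; last by exists (subst1 0 (Var 0) p).
by apply/(class_of_eq Rc); apply: interchangeable_leibniz.
Qed.

Lemma leibniz_constant T p q :
  interchangeable -> is_theory T -> (forall q, T (subst1 0 q p)) ->
  T q <-> leibniz T q (subst1 0 q p).
Proof.
move=> lI thT Tp; split=> [Tq|qp]; first exact: interchangeable_leibniz.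
exact: (leibniz_compat (congr_sym (leibniz_congruence T) qp)).
Qed.

(** * Matrix semantics whose nonempty designated sets are singletons *)

Section MatrixSemantics.
Variables (M : set (lmatrix L)) (p : form L).
Hypotheses (semM : matrix_semantics l M) (px : in_x p).
Hypothesis Mp : forall A, M A -> designated A <> set0 -> designates_only A p.

Lemma designates_only_interchangeable : interchangeable.
Proof.
move=> T q q' r thT rx Tq Tq' Tr.
apply/thT/semM => A MA h homh hT.
have inT t : T t -> designated A (h t) by move=> Tt; apply: hT; exists t.
have [A0|a [_ Aa]] := Mp MA.
  by have := inT _ Tq; rewrite A0.
have := inT _ Tr; rewrite !(hom_subst1 _ homh) //.
by move: (inT _ Tq) (inT _ Tq'); rewrite Aa /= => -> ->.
Qed.

Lemma designates_only_constant T q q' :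
  is_theory T -> T q -> T (subst1 0 q' p).
Proof.
move=> thT Tq; apply/thT/semM => A MA h homh hT.
have Aq : designated A (h q) by apply: hT; exists q.
have [A0|a [pa Aa]] := Mp MA; first by rewrite A0 in Aq.
by rewrite Aa (hom_subst1 _ homh).
Qed.

End MatrixSemantics.

(** For the converse the Leibniz matrices of the theories serve as semantics, with a collapsed
    theorem as the constant term. *)
Lemma assertionalP :
  assertional l <-> interchangeable /\ exists p, entails l set0 p.
Proof.
split=> [[M [p [semM px Mp]]]|[lI [q lq]]].
  split; first by apply: (designates_only_interchangeable semM (p := p)) => A /Mp.
  exists p; apply/semM => A /Mp[a [pa Aa]] h homh _.
  by rewrite Aa (hom_eval _ homh) eval_in_x.
pose p := @eval L (form_algebra L) (fun=> Var 0) q.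
have px : in_x p := in_x_collapse q.
exists [set A | exists2 T, is_theory T & A = leibniz_matrix T], p.
split=> //; first exact: leibniz_matrix_semantics.
move=> _ [T thT ->]; apply: leibniz_matrix_designates_only => // r.
exact: theorem_collapse.
Qed.

Lemma almost_assertionalP :
  almost_assertional l <->
  [/\ forall p, ~ entails l set0 p, interchangeable &
      exists2 p, in_x p &
        forall T q r, is_theory T -> T q -> T (subst1 0 r p)].
Proof.
split=> [[noth [M [p [semM px Mp]]]]|[noth lI [p px Tp]]]; split=> //.
- exact: (designates_only_interchangeable semM Mp).
- exists p => // T q r; exact: (designates_only_constant semM px Mp).
exists [set A | exists2 T, is_theory T & A = leibniz_matrix T], p.
split=> //; first exact: leibniz_matrix_semantics.
move=> _ [T thT ->] Tn0; apply: leibniz_matrix_designates_only => // r.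
have /set0P[_ [q Tq _]] : designated (leibniz_matrix T) != set0 by apply/eqP.
exact: Tp thT Tq.
Qed.

(** * The rule sets *)

Lemma valid_U f :
  valid l (rules_U f) ->
  forall T p q n, is_theory T -> T p -> T q -> T (boxn f n p) -> T (boxn f n q).
Proof.
move=> lU T p q n thT Tp Tq Tnp.
pose s := @eval L (form_algebra L) (fun m => if m is 0 then p else q).
have sn m t : s (boxn f m t) = boxn f m (s t).
  exact: (hom_boxn _ _ _ (eval_is_hom _)).
have ss : is_substitution s by [].
have := lU _ (ex_intro _ n erefl); move/(theory_rule thT ss).
by rewrite /= sn; apply=> _ [[]|] ->; rewrite ?sn.
Qed.

Lemma valid_S f k i :
  valid l (rules_S f k i) ->
  forall T p n, is_theory T -> T p ->
    T (boxn f (k + n) p) <-> T (boxn f n (Const i)).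
Proof.
move=> lS T p n thT Tp.
have ss : is_substitution (subst1 0 p) by [].
split=> Tn.
  have := lS _ (ex_intro _ n (or_introl erefl)); move/(theory_rule thT ss).
  by rewrite /= subst1_boxn; apply=> _ [] ->; rewrite ?subst1_boxn.
have := lS _ (ex_intro _ n (or_intror erefl)); move/(theory_rule thT ss).
by rewrite /= subst1_boxn; apply=> _ [] ->; rewrite ?subst1_boxn.
Qed.

(** If [boxn f a p] is in [T], the rules U transfer exponents between it and [p]: this gives closure
    under sums and differences. They also make [D] the same for all members of [T]. *)
Lemma theory_exponents f T p :
  valid l (rules_U f) -> is_theory T -> T p ->
  exists D, forall q n, T q -> T (boxn f n q) <-> D %| n.
Proof.
move=> /valid_U lU thT Tp.
have [//|a b Ta Tb|a b Ta|D DP] :=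
    @nat_closed_multiples (fun n => T (boxn f n p)).
- by rewrite addnC boxnD; apply: lU Tb.
- by rewrite addnC boxnD; apply: lU.
by exists D => q n Tq; rewrite -DP; split; apply: lU.
Qed.

Lemma theory_gcd_diff f T s (u v : 'I_s -> nat) D :
  (forall q n, T q -> T (boxn f n q) <-> D %| n) ->
  (forall j, u j < v j) -> premises f u v `<=` T -> D %| gcd_diff u v.
Proof.
move=> DP uv preT; apply/dvdn_biggcdP => j _.
have Tu : T (boxn f (u j) (Var 0)) by apply: preT; left; exists j.
apply/(DP _ _ Tu); rewrite -boxnD subnK; last exact: ltnW.
by apply: preT; right; exists j.
Qed.

Lemma valid_R f k i : valid l (rules_U f) -> valid l (rules_R f k i).
Proof.
move=> lU _ [t [s [g [u [v [uv dg ->]]]]]] /=.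
apply: entails_theories => T thT preT.
have Tt : T (boxn f t (Var 0)) by apply: preT; left.
have [D DP] := theory_exponents lU thT Tt.
rewrite addnC boxnD; apply/DP => //; apply: dvdn_trans dg.
by apply: (theory_gcd_diff DP uv) => q preq; apply: preT; right.
Qed.

Lemma valid_I f k i :
  0 < k -> valid l (rules_U f) -> valid l (rules_S f k i) ->
  valid l (rules_I f k i).
Proof.
move=> k0 lU lS _ [s [g [u [v [uv dg ->]]]]] /=.
apply: entails_theories => T thT preT.
case: s u v uv dg preT => [|s] u v uv dg preT.
  (* With no pairs the gcd is 0, which would force [g + k = 0] against [0 < k]. *)
  by move: dg; rewrite /gcd_diff big_ord0 dvd0n; lia.
have Tu : T (boxn f (u ord0) (Var 0)) by apply: preT; left; exists ord0.
have [D DP] := theory_exponents lU thT Tu.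
apply/(valid_S lS _ thT Tu)/DP => //; rewrite addnC; apply: dvdn_trans dg.
exact: (theory_gcd_diff DP uv preT).
Qed.

Lemma valid_USRI f k i :
  0 < k ->
  valid l (rules_U f `|` rules_S f k i `|` rules_R f k i `|` rules_I f k i) <->
  valid l (rules_U f) /\ valid l (rules_S f k i).
Proof.
move=> k0; split=> [lX|[lU lS]].
  by split=> r Xr; apply: lX; left; left; [left|right].
move=> r [[[]|]|]; [exact: lU|exact: lS|exact: valid_R|exact: valid_I].
Qed.

(** * Sufficiency *)

Lemma assertional_algebraic : assertional l -> has_algebraic_semantics l.
Proof.
case/assertionalP => lI [q lq]; pose p := @eval L (form_algebra L) (fun=> Var 0) q.
apply/algebraic_semanticsP; exists [set (Var 0, p)]; split.
  by move=> _ ->; split=> //; apply: in_x_collapse.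
move=> T thT; exists (leibniz T); split; first exact: leibniz_congruence.
have Tp r : T (subst1 0 r p) by apply: theorem_collapse.
move=> r; rewrite (leibniz_constant r lI thT Tp).
by split=> [rp _ ->|/(_ _ erefl)].
Qed.

(** The congruence collapses [T] to one class and is the identity elsewhere; a formula outside [T]
    is never equal to its own box. *)
Lemma box_closed_algebraic f :
  entails l [set Var 0] (Box f (Var 0)) -> has_algebraic_semantics l.
Proof.
move=> lB; apply/algebraic_semanticsP; exists [set (Var 0, Box f (Var 0))].
split=> [_ ->//|T thT]; exists (fun p q => p = q \/ T p /\ T q).
have TB p : T p -> T (Box f p).
  have ss : is_substitution (subst1 0 p) by [].
  by move=> Tp; apply: (theory_rule thT ss lB) => _ ->.
split.
  split=> [p|p q [->|[]]|p q r [->//|[Tp Tq]] [<-|[_ Tr]]|g p q [->|[Tp Tq]]];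
    [by left|by left|by right|by right|by right|by left|].
  by rewrite (unary_unique g f); right; split; apply: TB.
move=> q; split=> [Tq _ ->|/(_ _ erefl)[/Box_neq|[]]//].
by right; split=> //; apply: TB.
Qed.

Lemma valid_US_algebraic f k i :
  0 < k -> valid l (rules_U f) -> valid l (rules_S f k i) ->
  has_algebraic_semantics l.
Proof.
move=> k0 lU lS; apply/algebraic_semanticsP.
exists [set (boxn f k (Var 0), Const i)]; split.
  by move=> _ ->; split=> //; apply: in_x_boxn_var.
(* As [k] is positive, the equation is never a syntactic identity, so [eq] is a suitable congruence
   for the empty theory. *)
have kc p : boxn f k p <> Const i by move/boxn_const; lia.
move=> T thT; have [[p Tp]|T0] := pselect (exists p, T p); last first.
  exists eq; split=> [|q]; first exact: congruence_eq.
  split=> [Tq|/(_ _ erefl)/=]; first by case: T0; exists q.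
  by rewrite subst1_boxn => /kc.
have [D DP] := theory_exponents lU thT Tp.
have DS n : T (boxn f n (Const i)) <-> D %| k + n.
  by rewrite -(DP _ _ Tp) (valid_S lS).
(* [act q n] says that [q] behaves like [boxn f n (Const i)] once [boxn f k p] is identified with
   [Const i] for [p] in [T]. Such an [n] is determined modulo [D], which makes the relation below
   transitive. *)
pose act q n := q = boxn f n (Const i) \/ exists2 p, T p & q = boxn f (k + n) p.
have act_uniq q m n : act q m -> act q n -> m = n %[mod D].
  have cc a b : boxn f a (Const i) = boxn f b (Const i) :> form L -> a = b.
    by elim: a b => [|a IHa] [|b] //= [] /IHa ->.
  have cp a b r : T r -> boxn f a (Const i) = boxn f (k + b) r -> a = b %[mod D].
    move=> Tr; have [ab|ab] := leqP (k + b) a; last first.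
      rewrite -(subnKC (ltnW ab)) boxnD => /boxn_inj/esym/boxn_const; lia.
    rewrite -{1}(subnKC ab) boxnD => /boxn_inj/esym rE; move: Tr; rewrite rE DS.
    by move=> dv; apply/eqP; rewrite eqn_mod_dvd; [apply: etrans dv; congr dvdn|]; lia.
  have pp a b r r' : b <= a -> T r -> T r' ->
      boxn f (k + a) r = boxn f (k + b) r' -> a = b %[mod D].
    move=> ba Tr Tr'; rewrite (_ : k + a = k + b + (a - b)); last by lia.
    rewrite boxnD => /boxn_inj r'E; move: Tr'; rewrite -r'E DP // => dv.
    by apply/eqP; rewrite eqn_mod_dvd.
  case=> [->|[r Tr ->]] [|[r' Tr']].
  - by move/cc->.
  - exact: cp.
  - by move/esym => E; apply/esym; apply: cp Tr E.
  have [mn|/ltnW mn] := leqP n m; first exact: pp.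
  by move=> /esym E; apply/esym; apply: (pp _ _ _ _ mn _ _ E).
have actB g q n : act q n -> act (Box g q) n.+1.
  rewrite (unary_unique g f) => -[->|[r Tr ->]]; [by left|right].
  by exists r => //; rewrite addnS.
exists (fun q r => q = r \/ exists m n, [/\ act q m, act r n & m = n %[mod D]]).
split.
  split=> [q|q r [->|[m [n [qm rn mn]]]]
          |q r t [->//|[m [n [qm rn mn]]]] [<-|[m' [n' [rm tn mn']]]]
          |g q r [->|[m [n [qm rn mn]]]]].
  - by left.
  - by left.
  - by right; exists n, m.
  - by right; exists m, n.
  - right; exists m, n'; split=> //; rewrite mn -mn'; exact: act_uniq rn rm.
  - by left.
  - right; exists m.+1, n.+1; split; try exact: actB.
    by rewrite -addn1 -modnDml mn modnDml addn1.
move=> q; have qE : subst1 0 q (boxn f k (Var 0)) = boxn f k q.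
  by rewrite subst1_boxn.
split=> [Tq _ ->|/(_ _ erefl)] /=; rewrite {}qE.
  right; exists 0, 0; split=> //; last by left.
  by right; exists q => //; rewrite addn0.
case=> [/kc//|[m [n [qm cn mn]]]].
have n0 : n = 0 by case: cn => [/esym/boxn_const//|[r _ /esym/boxn_const]]; lia.
have {mn}Dm : D %| m by rewrite /dvdn mn n0 mod0n.
case: qm => [qE|[r Tr]]; last first.
  by rewrite boxnD => /boxn_inj ->; apply/DP.
have [km|km] := leqP k m; last first.
  move: qE; rewrite -(subnKC (ltnW km)) boxnD => /boxn_inj/boxn_const; lia.
move: qE; rewrite -(subnKC km) boxnD => /boxn_inj ->; apply/DS.
by rewrite subnKC.
Qed.

Lemma almost_assertional_algebraic tau :
  almost_assertional l -> equations_in_x tau ->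
  ~ (exists s : form L -> form L,
       is_substitution s /\ forall e, tau e -> s e.1 = s e.2) ->
  (forall e, tau e -> forall (v : nat) (p : form L),
     interderivable l [set Var 0; subst1 v e.1 p] [set subst1 v e.2 p; Var 0]) ->
  has_algebraic_semantics l.
Proof.
case/almost_assertionalP => noth lI [p px Tp] tau_x nosub tauT.
(* The added equation defines the nonempty theories through their Leibniz congruences, while [tau]
   keeps every formula out of the empty one. *)
apply/algebraic_semanticsP; exists (tau `|` [set (Var 0, p)]); split.
  by move=> e [/tau_x//|->].
move=> T thT; have [[q0 Tq0]|T0] := pselect (exists q, T q); last first.
  exists eq; split=> [|q]; first exact: congruence_eq.
  split=> [Tq|qE]; first by case: T0; exists q.
  by case: nosub; exists (subst1 0 q); split=> // e te; apply: qE; left.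
exists (leibniz T); split; first exact: leibniz_congruence.
have {}Tp r : T (subst1 0 r p) by apply: Tp Tq0.
move=> q; split=> [Tq e [te|->]|/(_ _ (or_intror erefl))].
- move=> r rx; have [e1x e2x] := tau_x _ te.
  have ss : is_substitution (subst1 0 q) by [].
  rewrite -!(substitution_subst1 _ ss) //.
  have [l12 l21] := tauT _ te 0 r.
  split=> Tr.
    by apply: (theory_rule thT ss (l12 _ (or_introl erefl))) => _ [] ->.
  by apply: (theory_rule thT ss (l21 _ (or_intror erefl))) => _ [] ->.
- exact: ((leibniz_constant q lI thT Tp).1 Tq).
- exact: (leibniz_constant q lI thT Tp).2.
Qed.

(** * Necessity *)

Lemma no_box_interchangeable : (unary_sym L -> False) -> interchangeable.
Proof. by move=> nof T p q [n|c|f r] _ //= ->. Qed.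

(** Every formula is a variable or a constant. If [tau] equates [x] with some [c], then [c] lies in
    every nonempty theory. Otherwise [tau] has only variable-free equations and [x = x], so a
    nonempty theory contains all formulas. *)
Lemma no_box_constant tau :
  (unary_sym L -> False) -> equations_in_x tau ->
  (forall T, is_theory T -> exists R, theory_congruence tau T R) ->
  exists2 p, in_x p & forall T q r, is_theory T -> T q -> T (subst1 0 r p).
Proof.
move=> nof tau_x congrT.
have [[c tc]|notc] := pselect
    (exists c, tau (Var 0, Const c) \/ tau (Const c, Var 0)).
  exists (Const c) => // T q r thT Tq; have [R TcR] := congrT T thT.
  apply: (theory_congruence_compat TcR _ Tq); have [Rc TR] := TcR.
  by case: tc => /((TR q).1 Tq) //; apply: congr_sym.
exists (Var 0) => // T q r thT Tq; have [R [Rc TR]] := congrT T thT.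
apply/TR => -[e1 e2] te; have := (TR q).1 Tq _ te; have [] := tau_x _ te.
case: e1 te => [m|c|f]; case: e2 => [n|d|g] te //=.
- by move=> -> -> _; apply: congr_refl.
- by move=> m0; case: notc; exists d; left; rewrite -m0.
- by move=> _ n0; case: notc; exists c; right; rewrite -n0.
Qed.

(** * The equations of an algebraic semantics in the presence of a box *)

Section Necessity.
Variables (tau : set (equation L)) (f : unary_sym L).
Hypothesis tau_x : equations_in_x tau.

Definition var_const m n c :=
  tau (boxn f m (Var 0), boxn f n (Const c)) \/
  tau (boxn f n (Const c), boxn f m (Var 0)).

Definition var_var a b :=
  tau (boxn f a (Var 0), boxn f b (Var 0)) \/
  tau (boxn f b (Var 0), boxn f a (Var 0)).

Section Congruence.
Variables (T : set (form L)) (R : form L -> form L -> Prop).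
Hypothesis TcR : theory_congruence tau T R.

Let Rc := TcR.1.

Lemma congr_var_const q m n c :
  T q -> var_const m n c -> R (boxn f m q) (boxn f n (Const c)).
Proof.
move=> /TcR.2 Tq [] /Tq; rewrite /= !subst1_boxn //.
exact: congr_sym.
Qed.

Lemma congr_var_var q a b : T q -> var_var a b -> R (boxn f a q) (boxn f b q).
Proof.
move=> /TcR.2 Tq [] /Tq; rewrite /= !subst1_boxn //.
exact: congr_sym.
Qed.

(** The variable-free equations of [tau] need no check, since they already hold because of [p]. *)
Lemma theory_boxn_intro p q : T p ->
  (forall m n c, var_const m n c -> R (boxn f m q) (boxn f n (Const c))) ->
  (forall a b, var_var a b -> R (boxn f a q) (boxn f b q)) -> T q.
Proof.
move=> /TcR.2 Tp vc vv; apply/TcR.2 => -[e1 e2] te; have := Tp _ te.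
have [/= /(in_x_boxn f)[m mE] /(in_x_boxn f)[n nE]] := tau_x te.
case: mE nE te => [->|[c ->]] [->|[d ->]] te; rewrite !subst1_boxn //= => _.
- by apply: vv; left.
- by apply: vc; left.
- by apply: (congr_sym Rc); apply: vc; right.
Qed.

Lemma congr_boxn_shift j a b p q :
  R (boxn f a p) (boxn f b q) -> R (boxn f (j + a) p) (boxn f (j + b) q).
Proof. by move=> ?; rewrite !boxnD; apply: congr_boxn. Qed.

End Congruence.

Hypothesis congrT :
  forall T, is_theory T -> exists R, theory_congruence tau T R.

Lemma box_closed_or_var_const :
  entails l [set Var 0] (Box f (Var 0)) \/ exists m n c, var_const m n c.
Proof.
have [vc|novc] := pselect (exists m n c, var_const m n c).
  by right.
left; apply: entails_theories => T thT Tx; have [R TcR] := congrT thT.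
have Tx0 : T (Var 0) by apply: Tx.
apply: (theory_boxn_intro TcR Tx0) => [m n c vc|a b vv].
  by case: novc; exists m, n, c.
have := congr_boxn_shift TcR 1 (congr_var_var TcR Tx0 vv).
by rewrite ![1 + _]addnC !boxnD.
Qed.

Lemma theory_boxn_exchange T p q j :
  is_theory T -> T p -> T q -> T (boxn f j p) -> T (boxn f j q).
Proof.
move=> thT Tp Tq Tj; have [R TcR] := congrT thT; have Rc := TcR.1.
have vcT := congr_var_const TcR.
apply: (theory_boxn_intro TcR Tp) => [m n c vc|a b vv]; last first.
  rewrite -!boxnD (addnC a) (addnC b).
  exact: (congr_boxn_shift TcR _ (congr_var_var TcR Tq vv)).
(* It remains to compare [boxn f j q] with [boxn f j p] under [m] boxes; there both agree with
   [boxn f (j + n) (Const c)]. *)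
apply: (congr_trans Rc _ (vcT _ _ _ _ Tj vc)).
rewrite -!boxnD (addnC m); apply: (congr_boxn_shift TcR).
exact: (congr_trans Rc (vcT _ _ _ _ Tq vc) (congr_sym Rc (vcT _ _ _ _ Tp vc))).
Qed.

Lemma box_interchangeable : interchangeable.
Proof.
move=> T p q r thT /(in_x_boxn f)[n rE] Tp Tq.
case: rE => [->|[c ->]]; rewrite !subst1_boxn //=.
exact: theory_boxn_exchange.
Qed.

Lemma box_valid_U : valid l (rules_U f).
Proof.
move=> _ [n ->]; apply: entails_theories => T thT GT.
by apply: (theory_boxn_exchange (p := Var 0)) => //; apply: GT; [do 2 left|left; right|right].
Qed.

(** * Consequences of an equation between [x] and a constant with the least power of [x] *)

Section Minimal.
Variables (m n : nat) (c : const_sym L).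
Hypothesis vc : var_const m n c.
Hypothesis vc_min : forall m' n' c', var_const m' n' c' -> m <= m'.

Lemma loop_constant T p a d :
  a < m -> 0 < d -> var_var a (a + d) -> is_theory T -> T p ->
  T (boxn f (n + m * d - m) (Const c)).
Proof.
move=> am d0 vv thT Tp; have [R TcR] := congrT thT; have Rc := TcR.1.
have mmd : m <= m * d by apply: leq_pmulr.
have vcp := congr_var_const TcR Tp vc.
have loop j r : a <= r -> R (boxn f (r + j * d) p) (boxn f r p).
  move=> ar; elim: j => [|j IHj]; first by rewrite addn0; apply: congr_refl.
  apply: congr_trans IHj => //; rewrite mulSn.
  have /(congr_boxn_shift TcR (r - a + j * d)) := congr_var_var TcR Tp vv.
  have -> : r - a + j * d + a = r + j * d by lia.
  have -> : r - a + j * d + (a + d) = r + (d + j * d) by lia.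
  exact: congr_sym.
have tr j : R (boxn f j (boxn f (n + m * d - m) (Const c))) (boxn f (j + m * d) p).
  rewrite -boxnD; have := congr_boxn_shift TcR (j + m * d - m) vcp.
  have -> : j + m * d - m + m = j + m * d by lia.
  have -> : j + m * d - m + n = j + (n + m * d - m) by lia.
  exact: congr_sym.
apply: (theory_boxn_intro TcR Tp) => [m' n' c' vc'|a' b' vv'].
  apply: (congr_trans Rc (tr _)).
  apply: (congr_trans Rc (loop _ _ _) (congr_var_const TcR Tp vc')).
  by apply: (leq_trans (ltnW am)); apply: vc_min vc'.
apply: (congr_trans Rc (tr _)); apply: (congr_trans Rc _ (congr_sym Rc (tr _))).
by rewrite (addnC a') (addnC b'); exact: (congr_boxn_shift TcR _ (congr_var_var TcR Tp vv')).
Qed.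

Hypothesis vv_min : forall a b, var_var a b -> a != b -> m <= a.

Lemma var_var_sym a b : var_var a b -> var_var b a.
Proof. by case; [right|left]. Qed.

(* By minimality of m, an equation only involves powers [Box^j x] with [m <= j],
   so [q] and [r] satisfy the same equations once [Box^m q] and [Box^m r] agree. *)
Lemma theory_boxn_transfer T R p q r :
  is_theory T -> theory_congruence tau T R -> T p ->
  R (boxn f m q) (boxn f m r) -> T q -> T r.
Proof.
move=> thT TcR Tp Rqr Tq; have Rc := TcR.1.
have tr j : m <= j -> R (boxn f j q) (boxn f j r).
  by move=> mj; rewrite -(subnK mj); apply: (congr_boxn_shift TcR).
apply: (theory_boxn_intro TcR Tp) => [m' n' c' vc'|a b vv].
  apply: (congr_trans Rc (congr_sym Rc (tr _ (vc_min vc')))).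
  exact: (congr_var_const TcR Tq vc').
have [->|ab] := eqVneq a b; first exact: congr_refl.
have ma := vv_min vv ab; have mb := vv_min (var_var_sym vv) _.
apply: (congr_trans Rc (congr_sym Rc (tr _ ma))).
apply: (congr_trans Rc (congr_var_var TcR Tq vv)); apply: tr.
by apply: mb; rewrite eq_sym.
Qed.

(** Under [m] boxes the constant becomes [boxn f n (Const c)], which [vc] equates with
    [boxn f m p]. *)
Lemma deep_constant T p :
  m <= n -> is_theory T -> T p -> T (boxn f (n - m) (Const c)).
Proof.
move=> mn thT Tp; have [R TcR] := congrT thT.
apply: (theory_boxn_transfer thT TcR Tp _ Tp); rewrite -boxnD subnKC //.
exact: (congr_var_const TcR Tp vc).
Qed.

(** Applying [m - n + j] boxes to [vc] shows that the two formulas of the rule agree under [m]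
    boxes, so each transfers to the other. *)
Lemma shallow_valid_S : n < m -> valid l (rules_S f (m - n) c).
Proof.
move=> nm; have tr T j : is_theory T -> T (Var 0) ->
    T (boxn f (m - n + j) (Var 0)) <-> T (boxn f j (Const c)).
  move=> thT Tx; have [R TcR] := congrT thT; have Rc := TcR.1.
  have Rj : R (boxn f m (boxn f (m - n + j) (Var 0)))
              (boxn f m (boxn f j (Const c))).
    have := congr_boxn_shift TcR (m - n + j) (congr_var_const TcR Tx vc).
    by rewrite -!boxnD addnC (_ : m - n + j + n = m + j) //; lia.
  by split; apply: (theory_boxn_transfer thT TcR Tx) => //; apply: congr_sym.
move=> _ [j [->|->]]; apply: entails_theories => T thT GT.
  by apply/tr => //; apply: GT; [left|right].
by apply/tr => //; apply: GT; [left|right].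
Qed.

End Minimal.

Lemma box_necessity :
  ~ entails l [set Var 0] (Box f (Var 0)) ->
  (exists2 p, in_x p & forall T q r, is_theory T -> T q -> T (subst1 0 r p)) \/
  exists k i, 0 < k /\ valid l (rules_S f k i).
Proof.
move=> nB; have [//|[m0 [n0 [c0 vc0]]]] := box_closed_or_var_const.
have exm : exists m, `[< exists n c, var_const m n c >].
  by exists m0; apply/asboolP; exists n0, c0.
case: (ex_minnP exm) => m /asboolP[n [c vc]] minm.
have vc_min m' n' c' : var_const m' n' c' -> m <= m'.
  by move=> vc'; apply: minm; apply/asboolP; exists n', c'.
have const N : (forall T q, is_theory T -> T q -> T (boxn f N (Const c))) ->
    exists2 p, in_x p & forall T q r, is_theory T -> T q -> T (subst1 0 r p).
  move=> TN; exists (boxn f N (Const c)); first exact: in_x_boxn_const.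
  by move=> T q r thT Tq; rewrite subst1_boxn; apply: TN Tq.
(* A nontrivial equation between powers of [x] that starts below [m] gives a loop and hence a
   constant. Without one, the order of [m] and [n] decides. *)
have [[a [b [am ab vv]]]|novv] :=
    pselect (exists a b, [/\ a < m, a < b & var_var a b]).
  left; apply: (const (n + m * (b - a) - m)) => T q thT Tq.
  apply: (loop_constant vc vc_min am _ _ thT Tq); first by rewrite subn_gt0.
  by rewrite subnKC // ltnW.
have vv_min a b : var_var a b -> a != b -> m <= a.
  move=> vv ab; rewrite leqNgt; apply/negP => am; case: novv.
  have [lab|lba|eab] := ltngtP a b; first by exists a, b.
    by exists b, a; split=> //; [lia|case: vv; [right|left]].
  by rewrite eab eqxx in ab.
have [mn|nm] := leqP m n.
  by left; apply: (const (n - m)) => T q; apply: deep_constant.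
right; exists (m - n), c; split; first by rewrite subn_gt0.
exact: shallow_valid_S.
Qed.

End Necessity.
End Theories.

Theorem theorem10p2 (L : language) (l : logic L) :
  (has_algebraic_semantics l <->
   [\/ assertional l,
       exists f : unary_sym L, entails l [set Var 0] (Box f (Var 0)),
       exists (f : unary_sym L) (k : nat) (i : const_sym L),
         0 < k /\
         valid l (rules_U f `|` rules_S f k i `|` rules_R f k i
                  `|` rules_I f k i)
     | almost_assertional l /\
       exists tau : set (equation L),
         [/\ equations_in_x tau,
             ~ (exists s : form L -> form L,
                  is_substitution s /\ forall e, tau e -> s e.1 = s e.2) &
             forall e, tau e -> forall (v : nat) (p : form L),
               interderivable l [set Var 0; subst1 v e.1 p]
                                [set subst1 v e.2 p; Var 0]]]) /\
  (forall (f : unary_sym L) (k : nat) (i : const_sym L),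
     0 < k ->
     valid l (rules_U f `|` rules_S f k i `|` rules_R f k i
              `|` rules_I f k i) ->
     exists n : nat,
       [/\ 0 < n,
           valid l (rules_S f n i),
           forall m, 0 < m -> valid l (rules_S f m i) -> n <= m &
           valid l (rules_U f `|` rules_S f n i `|` rules_R f n i
                    `|` rules_I f n i)]).
Proof.
split; last first.
  move=> f k i k0 /(valid_USRI _ _ _ k0)[lU lS].
  have exk : exists n, (0 < n) && `[< valid l (rules_S f n i) >].
    by exists k; rewrite k0; apply/asboolP.
  case: (ex_minnP exk) => n /andP[n0 /asboolP lSn] minn.
  (* U does not mention [k], and with S at [n] it yields R and I at [n]. *)
  exists n; split=> // [m m0 lSm|]; last exact/valid_USRI.
  by apply: minn; rewrite m0; apply/asboolP.
split=> [|[|[f]|[f [k [i [k0 /(valid_USRI _ _ _ k0)[]]]]]|[la [tau []]]]];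
  [|exact: assertional_algebraic|exact: box_closed_algebraic
   |exact: valid_US_algebraic|exact: almost_assertional_algebraic].
case/algebraic_semanticsP => tau [tau_x congrT].
have [lB|nB] := pselect (exists f, entails l [set Var 0] (Box f (Var 0))).
  by constructor 2.
have lI : interchangeable l.
  have [[f]|nof] := pselect (inhabited (unary_sym L)).
    exact: box_interchangeable congrT.
  by apply: no_box_interchangeable => f; apply: nof.
have [thm|nothm] := pselect (exists p, entails l set0 p).
  by constructor 1; apply/assertionalP.
have [const|lS] : (exists2 p, in_x p & forall T q r,
      is_theory l T -> T q -> T (subst1 0 r p)) \/
    exists f k i, [/\ 0 < k, valid l (rules_U f) & valid l (rules_S f k i)].
- have [[f]|nof] := pselect (inhabited (unary_sym L)).
    have nBf : ~ entails l [set Var 0] (Box f (Var 0)) by move=> ?; apply: nB; exists f.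
    have [|[k [i [k0 lS]]]] := box_necessity tau_x congrT nBf; [by left|right].
    by exists f, k, i; split=> //; apply: box_valid_U congrT.
  by left; apply: (no_box_constant _ tau_x congrT) => f; apply: nof.
- constructor 4; split.
    by apply/almost_assertionalP; split=> // p lp; apply: nothm; exists p.
  exists tau; split=> // [[s [s_sub sE]]|e te v p].
    (* Without theorems the empty set is a theory, and a substitution unifying [tau] would put
       [s (Var 0)] into it. *)
    have th0 : is_theory l set0 by move=> p lp; case: nothm; exists p.
    have [R [Rc TR]] := congrT _ th0.
    have /TR // : forall e, tau e ->
        R (subst1 0 (s (Var 0)) e.1) (subst1 0 (s (Var 0)) e.2).
    move=> e te; have [e1 e2] := tau_x _ te.
    rewrite -!(substitution_subst1 _ s_sub) // !subst1_var0 sE //.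
    exact: congr_refl.
  (* Since [x] is in [T], the congruence of [T] identifies the two sides of [e] themselves, hence
     also inside any context. *)
  have subT T : is_theory l T -> T (Var 0) ->
      T (subst1 v e.1 p) <-> T (subst1 v e.2 p).
    move=> thT Tx; have [R TcR] := congrT T thT; have [Rc TR] := TcR.
    have Re : R e.1 e.2 by have := (TR _).1 Tx e te; rewrite !subst1_var0.
    split; apply: (theory_congruence_compat TcR); apply: congr_subst1 => //.
    exact: congr_sym.
  split=> _ [] ->; apply: entails_theories => T thT GT.
  + by apply/subT => //; apply: GT; [left|right].
  + by apply: GT; left.
  + by apply: GT; right.
  + by apply/subT => //; apply: GT; [right|left].
case: lS => f [k [i [k0 lU lS]]]; constructor 3; exists f, k, i.
by split=> //; apply/valid_USRI.
Qed.
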